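(* Let $\lambda\ge 0$ and let $\gamma\subset\mathbb{R}^2$ be a smooth complete embedded $\lambda$-hypersurface ($\lambda$-curve), i.e. $H-\frac{\langle x,\mathbf{n}\rangle}{2}=\lambda$ on $\gamma$. Then $\gamma$ is either a line or a round circle.
   Context: Curves are connected and without boundary. For a smooth curve $\gamma\subset\mathbb{R}^2$, $x$ is the position vector, $\mathbf{n}$ is the outward pointing unit normal (a chosen unit normal if $\gamma$ is noncompact), and $H=\mathrm{div}_\gamma\mathbf{n}=-\langle\nabla_{\gamma'}\gamma',\mathbf{n}\rangle$ (with $\gamma$ parametrized by arclength) is the curvature, so that $H=1/r$ on the circle of radius $r$ with outward normal. *)

(* Defs.v *)
From HB Require Import structures.
From mathcomp Require Import all_boot all_order all_algebra.
From mathcomp Require Import all_classical all_reals all_analysis.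
Set Implicit Arguments.
Unset Strict Implicit.
Unset Printing Implicit Defensive.
Import Order.TTheory GRing.Theory Num.Theory.
Import numFieldNormedType.Exports.
Local Open Scope ring_scope.
Local Open Scope classical_set_scope.

(* The Euclidean inner product is written explicitly because the norm that    *)
(* the library puts on row vectors is the sup norm. That norm is used below   *)
(* only for the topology and for boundedness, which do not depend on it.      *)
Definition dot (R : realType) (u v : 'rV[R]_2) : R := \sum_i u 0 i * v 0 i.

Definition smooth (R : realType) (c : R -> 'rV[R]_2) : Prop :=
  forall (k : nat) (t : R), derivable (derive1n k c) t 1.

(* A one-dimensional embedded submanifold without boundary: near each of its  *)
(* points, g is the image of a regular smooth parametrization by R which is a *)
(* homeomorphism onto its image, with inverse b.                              *)
Definition embedded_curve (R : realType) (g : set 'rV[R]_2) : Prop :=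
  forall p, g p ->
  exists (V : set 'rV[R]_2) (a : R -> 'rV[R]_2) (b : 'rV[R]_2 -> R),
    [/\ open V /\ V p,
        smooth a /\ (forall t, derive1 a t != 0),
        range a = g `&` V,
        cancel a b &
        {within g `&` V, continuous b}].

Definition arclength_param (R : realType) (g : set 'rV[R]_2)
    (c : R -> 'rV[R]_2) : Prop :=
  [/\ smooth c, forall s, g (c s) & forall s, dot (derive1 c s) (derive1 c s) = 1].

(* Geodesic completeness for the induced metric. The unit-speed geodesics of  *)
(* a curve are its arclength parametrizations, and the two directions at p    *)
(* are exchanged by s |-> - s.                                                *)
Definition complete_curve (R : realType) (g : set 'rV[R]_2) : Prop :=
  forall p, g p -> exists2 c, arclength_param g c & c 0 = p.

Definition unit_normal (R : realType) (g : set 'rV[R]_2)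
    (n : 'rV[R]_2 -> 'rV[R]_2) : Prop :=
  [/\ {within g, continuous n},
      forall p, g p -> dot (n p) (n p) = 1 &
      forall a : R -> 'rV[R]_2, smooth a -> (forall t, g (a t)) ->
        forall t, dot (derive1 a t) (n (a t)) = 0].

(* The region enclosed by g: the union of the bounded connected components    *)
(* of its complement.                                                         *)
Definition enclosed (R : realType) (g : set 'rV[R]_2) : set 'rV[R]_2 :=
  [set x | ~ g x /\ bounded_set (connected_component (~` g) x)].

Definition outward_pointing (R : realType) (g : set 'rV[R]_2)
    (n : 'rV[R]_2 -> 'rV[R]_2) : Prop :=
  forall p, g p -> \forall t \near (0 : R)^'+,
    enclosed g (p - t *: n p) /\ ~ (g `|` enclosed g) (p + t *: n p).

Definition curvature (R : realType) (n : 'rV[R]_2 -> 'rV[R]_2)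
    (c : R -> 'rV[R]_2) (s : R) : R := - dot (derive1n 2 c s) (n (c s)).

Definition lambda_curve (R : realType) (lambda : R) (g : set 'rV[R]_2)
    (n : 'rV[R]_2 -> 'rV[R]_2) : Prop :=
  forall c, arclength_param g c ->
  forall s, curvature n c s - dot (c s) (n (c s)) / 2 = lambda.

Definition is_line (R : realType) (g : set 'rV[R]_2) : Prop :=
  exists p v : 'rV[R]_2, v != 0 /\ g = range (fun t : R => p + t *: v).

Definition is_round_circle (R : realType) (g : set 'rV[R]_2) : Prop :=
  exists (p : 'rV[R]_2) (r : R),
    0 < r /\ g = [set x | dot (x - p) (x - p) = r ^+ 2].

(* Main.v *)
Require Import Defs.
From HB Require Import structures.
From mathcomp Require Import all_boot all_order all_algebra.
From mathcomp Require Import all_classical all_reals all_analysis.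
From mathcomp Require Import ring lra zify.
Set Implicit Arguments.
Unset Strict Implicit.
Unset Printing Implicit Defensive.
Import Order.TTheory GRing.Theory Num.Theory.
Import numFieldNormedType.Exports.
Local Open Scope ring_scope.
Local Open Scope classical_set_scope.

(** Along an arclength parametrization [(x, y)] of the curve, with tangent
    [T = (p, q)], put [N = (q, - p)]. The unit normal is [n = e N] for a
    constant sign [e], and the equation becomes [T' = - kappa N] with
    [kappa = mu + <x, N> / 2] and [mu = e lambda]. Differentiating gives
    [kappa' = kappa <x, T> / 2], so that [kappa = E exp (|x|^2 / 4)]
    ([flow_gaussian]). If [E = 0] the curve is a line. Otherwise the curve can
    be oriented so that [kappa >= E > 0]; then the angle [t] of [N] is a
    parameter running over the whole of [R] ([flow_angle]), and [k = kappa],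
    as a function of [t], solves
       [k' = w],   [w' = 1 / (2 k) - k + mu],
    while the position is recovered as [2 (k - mu) N + 2 w T].

    Suppose that [k] is not constant. Uniqueness makes [k] symmetric about each
    of its critical points, which are therefore equally spaced; let [a] be
    their distance. Since [w'' = - (1 + 1 / (2 k^2)) w], comparison with the
    sine gives [a < pi] ([sturm]). Let [c] be critical. The points of parameters
    [c + t] and [c - t] are mirror images in the line spanned by [N c], and if
    [w (c + pi) > 0] then they coincide for some [t] between [pi / 2] and [pi]
    ([no_crossing]). The normals there differ, whereas on an embedded curve the
    normal is a function of the point. Thus [w (c + pi) <= 0] at all critical
    points [c]; as [w] changes sign from one interval between critical points
    to the next, this forces [a] to divide [pi] ([half_period_dvd_pi]). Hence
    [a <= pi / 2], and [k] is [2 pi]-periodic.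

    If [mu >= 0], an integral identity of Gage type shows [a > pi / 2]
    ([half_period_gt_pihalf]), a contradiction. If [mu < 0], then [e = - 1],
    and by periodicity the curve is compact, so that [n] points outwards; but at
    a point of the curve farthest from the origin [- n] is the outward radial
    direction, a contradiction ([not_enclosed_ray]). So [k] is constant and the
    curve is a circle about the origin.

    All of this concerns one arclength parametrization [c]. Its image is open in
    [g], by the local charts, and closed in [g], because two arclength
    parametrizations through the same point have the same image ([arclength_meet]);
    as [g] is connected, it is all of [g] ([range_arclength]). *)

(** * Calculus of everywhere differentiable real functions *)

Section Derives.
Context {R : realType}.
Implicit Types (f g df dg : R -> R) (a b c : R).

(** A derivative at every point, so that the rules below compose without side
    conditions on the point. *)
Definition derives f df := forall s : R, is_derive s 1 f (df s).

Lemma derives_ext f df dg : derives f df -> (forall s, df s = dg s) -> derives f dg.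
Proof. by move=> h e s; rewrite -e. Qed.

Lemma derives_cst c : derives (fun _ => c) (fun _ => 0).
Proof. by move=> s; exact: is_derive_cst. Qed.

Lemma derives_id : derives (fun s => s) (fun _ => 1).
Proof. by move=> s; exact: is_derive_id. Qed.

Lemma derivesN f df : derives f df -> derives (fun s => - f s) (fun s => - df s).
Proof. by move=> h s; exact: is_deriveN. Qed.

Lemma derivesD f g df dg : derives f df -> derives g dg ->
  derives (fun s => f s + g s) (fun s => df s + dg s).
Proof. by move=> h1 h2 s; exact: is_deriveD. Qed.

Lemma derivesM f g df dg : derives f df -> derives g dg ->
  derives (fun s => f s * g s) (fun s => f s * dg s + g s * df s).
Proof. by move=> h1 h2 s; exact: is_deriveM. Qed.

Lemma derives_sqr f df : derives f df ->
  derives (fun s => f s ^+ 2) (fun s => 2 * f s * df s).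
Proof.
move=> h; have := derivesM h h; under eq_fun do rewrite -expr2.
by move/derives_ext; apply => s; ring.
Qed.

Lemma derives_comp f g df dg : derives f df -> derives g dg ->
  derives (fun s => f (g s)) (fun s => df (g s) * dg s).
Proof.
move=> h1 h2 s; have := @is_derive1_comp _ f g s (df (g s)) (dg s) (h1 _) (h2 _).
by rewrite mulrC.
Qed.

Lemma derivesV f df : (forall s, f s != 0) -> derives f df ->
  derives (fun s => (f s)^-1) (fun s => - df s / f s ^+ 2).
Proof.
move=> f0 h s; have := h s => -[h1 h2]; split; first exact: derivableV.
by rewrite deriveV // h2 -[_ *: _]/(_ * _) mulrC mulrN mulNr.
Qed.

Lemma derives_cos f df : derives f df ->
  derives (fun s => cos (f s)) (fun s => - sin (f s) * df s).
Proof.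
move=> h; apply: (@derives_comp cos _ (fun x => - sin x) _ _ h) => s.
exact: is_derive_cos.
Qed.

Lemma derives_sin f df : derives f df ->
  derives (fun s => sin (f s)) (fun s => cos (f s) * df s).
Proof.
move=> h; apply: (@derives_comp sin _ cos _ _ h) => s.
exact: is_derive_sin.
Qed.

Lemma derives_exp f df : derives f df ->
  derives (fun s => expR (f s)) (fun s => expR (f s) * df s).
Proof.
move=> h; apply: (@derives_comp expR _ expR _ _ h) => s.
exact: is_derive_expR.
Qed.

Lemma derives_continuous f df : derives f df -> continuous f.
Proof.
move=> h s; apply/differentiable_continuous/derivable1_diffP.
by have [] := h s.
Qed.

Lemma derives_within f df (A : set R) : derives f df -> {within A, continuous f}.
Proof. by move=> /derives_continuous h; exact: continuous_subspaceT. Qed.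

Lemma derives_mvt f df a b : derives f df -> a < b ->
  exists2 c, a < c < b & f b - f a = df c * (b - a).
Proof.
move=> h ab; have [] := MVT ab (fun x _ => h x) (derives_within h).
by move=> c; rewrite in_itv /=; exists c.
Qed.

Lemma derives_lt f df a b : derives f df -> a < b ->
  (forall s, a < s < b -> 0 < df s) -> f a < f b.
Proof.
move=> h ab pos; have [c cab e] := derives_mvt h ab.
by rewrite -subr_gt0 e mulr_gt0 ?pos // subr_gt0.
Qed.

Lemma derives_le f df a b : derives f df -> a <= b ->
  (forall s, a < s < b -> 0 <= df s) -> f a <= f b.
Proof.
move=> h; rewrite le_eqVlt => /orP[/eqP <- //|ab] pos.
have [c cab e] := derives_mvt h ab.
by rewrite -subr_ge0 e mulr_ge0 ?pos // subr_ge0 ltW.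
Qed.

Lemma derives0_cst f : derives f (fun _ => 0) -> forall a b, f a = f b.
Proof.
move=> h a b; wlog ab : a b / a <= b => [W|].
  by case/orP: (le_total a b) => ab; [exact: W|apply/esym; exact: W].
apply/le_anti/andP; split; first exact: (derives_le h).
by have := derives_le (derivesN h) ab; rewrite lerN2 oppr0; apply.
Qed.

Lemma derives_unique f df dg : derives f df -> derives f dg -> forall s, df s = dg s.
Proof. by move=> h1 h2 s; have [_ <-] := h1 s; have [_ <-] := h2 s. Qed.

Lemma derives_ivt f df a b : derives f df -> a <= b -> f a * f b <= 0 ->
  exists2 c, a <= c <= b & f c = 0.
Proof.
move=> h ab s; have [|c ci fc] := IVT ab (derives_within h) (v := 0).
  by rewrite ge_min le_max; nra.
by exists c => //; move: ci; rewrite in_itv.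
Qed.

(** The product [f s * exp (- (M * s))] is nonincreasing and vanishes at 0. *)
Lemma gronwall0 f df M b : derives f df -> 0 <= b -> (forall s, 0 <= f s) ->
  f 0 = 0 -> (forall s, 0 < s < b -> df s <= M * f s) -> f b = 0.
Proof.
move=> h b0 f0 f00 le; apply/le_anti; rewrite f0 andbT.
have d : derives (fun s => - (f s * expR (- (M * s))))
   (fun s => (M * f s - df s) * expR (- (M * s))).
  apply: (derives_ext (derivesN (derivesM h (derives_exp (derivesN
    (derivesM (derives_cst M) derives_id)))))) => s /=; ring.
have := derives_le d b0; rewrite f00 mul0r oppr0 oppr_ge0.
rewrite pmulr_lle0 ?expR_gt0 //; apply => s sb.
by rewrite mulr_ge0 ?expR_ge0 // subr_ge0 le.
Qed.

End Derives.

Ltac derive_tac := repeat first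
  [ eassumption | apply: derives_cst | apply: derives_id
  | apply: derivesN | apply: derivesD | apply: derives_sqr | apply: derivesM
  | apply: derives_cos | apply: derives_sin | apply: derives_exp ].

(** * Sturm comparison with the sine *)

Section Sturm.
Context {R : realType}.
Implicit Types (f df ddf q : R -> R) (a b c : R).

Lemma derives_pos_right f df ddf b : derives f df -> derives df ddf ->
  f b = 0 -> 0 < df b -> exists2 d, 0 < d & forall s, b < s <= b + d -> 0 < f s.
Proof.
move=> h h' fb dfb.
have /cvgrPdist_lt/(_ _ dfb)[e /= e0 he] := derives_continuous h' (x := b).
exists (e / 2); first by rewrite divr_gt0.
move=> s /andP[bs se]; rewrite -fb; apply: (derives_lt h bs) => t /andP[bt ts].
have : `|df b - df t| < df b.
  by apply: he => /=; rewrite ltr_distl; apply/andP; split; lra.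
by move=> /ltr_distlBl; lra.
Qed.

Lemma first_zero f df ddf b c : derives f df -> derives df ddf ->
  f b = 0 -> 0 < df b -> b < c -> f c <= 0 ->
  exists a, [/\ b < a <= c, f a = 0 & forall s, b < s < a -> 0 < f s].
Proof.
move=> h h' fb dfb bc fc.
have [d d0 hd] := derives_pos_right h h' fb dfb.
have dc : b + d < c.
  by rewrite ltNge; apply/negP => cd; have := hd c; rewrite bc cd => /(_ isT); lra.
pose Z : set R := `[b + d, c] `&` [set s | f s = 0].
have fbd : 0 < f (b + d) by apply: hd; rewrite ltrDl d0 lexx.
have [z zi fz] : exists2 z, b + d <= z <= c & f z = 0.
  by apply: (derives_ivt h (ltW dc)); nra.
have cZ : compact Z.
  apply: (subclosed_compact _ (@segment_compact R (b + d) c)); last by move=> ? [].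
  apply: closedI; first exact: interval_closed.
  apply: (@closed_comp _ _ f [set 0]); last exact: closed_eq.
  by move=> x _; exact: (derives_continuous h).
have [] := compact_EVT_min (f := idfun) _ cZ.
- by exists z; split => //=; rewrite in_itv.
- by apply: continuous_subspaceT => x; exact: cvg_id.
move=> a; rewrite inE => -[/=]; rewrite in_itv /= => /andP[ba ac] fa amin.
exists a; split => //; first by apply/andP; split => //; lra.
move=> s /andP[bs sa]; rewrite ltNge; apply/negP => fs.
have [sd|sd] := leP s (b + d); first by have := hd s; rewrite bs sd => /(_ isT); lra.
have [t /andP[t1 t2] ft] : exists2 t, b + d <= t <= s & f t = 0.
  by apply: (derives_ivt h (ltW sd)); nra.
have := amin t; rewrite inE => /(_ _)/le_trans h1.
have /h1/(_ t2) : Z t by split => //=; rewrite in_itv /=; apply/andP; split; lra.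
lra.
Qed.

(** Comparison with [sin], which solves the same equation with [q = 1]: the
    Wronskian of [f] and [sin (s - b)] is strictly decreasing while [f > 0]. *)
Lemma sturm_wronskian f df q a b : derives f df ->
  derives df (fun s => - q s * f s) -> (forall s, 1 < q s) ->
  b < a <= b + pi -> (forall s, b < s < a -> 0 < f s) ->
  df a * sin (a - b) - f a * cos (a - b) < - f b.
Proof.
move=> h h' q1 /andP[ba ap] pos.
pose W s := f s * cos (s - b) - df s * sin (s - b).
have dW : derives W (fun s => (q s - 1) * f s * sin (s - b)).
  by apply: derives_ext; [rewrite /W; derive_tac|move=> s /=; ring].
have : W b < W a.
  apply: (derives_lt dW ba) => s /andP[bs sa].
  rewrite !mulr_gt0 ?subr_gt0 ?q1 ?pos ?bs ?sa //.
  by apply: sin_gt0_pi; apply/andP; split; lra.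
by rewrite /W subrr cos0 sin0; lra.
Qed.

Lemma sturm f df q b : derives f df -> derives df (fun s => - q s * f s) ->
  (forall s, 1 < q s) -> ~ (forall s, b < s < b + pi -> 0 < f s).
Proof.
move=> h h' q1 pos; have p0 := @pi_gt0 R.
have := @sturm_wronskian f df q (b + pi) b h h' q1.
rewrite lexx andbT ltrDl p0 [b + pi - b]addrAC subrr add0r sinpi cospi.
move=> /(_ isT pos).
have f0 c : c = b \/ c = b + pi -> 0 <= f c.
  move=> hc; rewrite leNgt; apply/negP => fc.
  have [t /andP[t1 t2] ft] : exists2 t,
      Num.min c (b + pi / 2) <= t <= Num.max c (b + pi / 2) & f t = 0.
    have fm : 0 < f (b + pi / 2) by apply: pos; apply/andP; split; lra.
    apply: (derives_ivt h); first by rewrite ge_min !le_max !lexx orbT.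
    by rewrite /Num.min /Num.max; case: ifP => _; nra.
  have := pos t; have [|] : t = c \/ b < t < b + pi.
    move: t1 t2; rewrite /Num.min /Num.max; case: hc => ->; case: ifP => ?.
    - move=> t1 t2; have [/eqP->|/negbTE tb] := boolP (t == b); [by left|right].
      by rewrite lt_neqAle t1 eq_sym tb /=; lra.
    - lra.
    - lra.
    - move=> t1 t2; have [/eqP->|/negbTE tb] := boolP (t == b + pi); [by left|right].
      by rewrite [t < _]lt_neqAle t2 tb andbT; lra.
  - by move=> tc; move: fc; rewrite -tc ft ltxx.
  - by move=> tb /(_ tb); rewrite ft ltxx.
have := f0 b (or_introl erefl); have := f0 _ (or_intror erefl).
lra.
Qed.

(** [sturm] provides a zero at distance less than [pi], and the sign of the
    Wronskian at the first one shows that [f] crosses 0 there. *)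
Lemma next_zero f df q b : derives f df -> derives df (fun s => - q s * f s) ->
  (forall s, 1 < q s) -> f b = 0 -> 0 < df b ->
  exists a, [/\ b < a < b + pi, f a = 0, df a < 0 & forall s, b < s < a -> 0 < f s].
Proof.
move=> h h' q1 fb dfb.
have [c /andP[bc cp] fc] : exists2 c, b < c < b + pi & f c <= 0.
  apply: contrapT => nex; apply: (sturm (b := b) h h' q1) => s sb.
  by rewrite ltNge; apply/negP => fs; apply: nex; exists s.
have [a [/andP[ba ac] fa pos]] := first_zero h h' fb dfb bc fc.
have ap : a < b + pi by lra.
exists a; split => //; first by rewrite ba.
have := sturm_wronskian h h' q1 _ pos; rewrite ba (ltW ap) => /(_ isT).
rewrite fa fb mul0r subr0 oppr0.
have : 0 < sin (a - b) by apply: sin_gt0_pi; apply/andP; split; lra.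
nra.
Qed.

End Sturm.

(** * The curvature as a function of the normal angle *)

Section CurvatureEquation.
Context {R : realType}.
Implicit Types (mu c : R) (k w : R -> R).

(** The second derivative of the curvature with respect to the angle of the
    normal, prescribed by the equation of lambda-curves. *)
Definition accel mu k (s : R) : R := (2 * k s)^-1 - k s + mu.

(** The positive lower bound makes the right-hand side Lipschitz along
    solutions. *)
Definition curvature_eq mu k w : Prop :=
  [/\ exists2 m, 0 < m & forall s, m <= k s,
      derives k w & derives w (accel mu k)].

Lemma curvature_eq_gt0 mu k w s : curvature_eq mu k w -> 0 < k s.
Proof. by case=> -[m m0 mk] _ _; exact: lt_le_trans (mk s). Qed.

Lemma curvature_eq_shift mu k w c : curvature_eq mu k w ->
  curvature_eq mu (fun s => k (c + s)) (fun s => w (c + s)).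
Proof.
have d : derives (fun s => c + s) (fun=> 1).
  by apply: derives_ext; [derive_tac|move=> s /=; rewrite add0r].
case=> -[m m0 mk] dk dw; split; first by exists m.
- by apply: (derives_ext (derives_comp dk d)) => s; rewrite mulr1.
- by apply: (derives_ext (derives_comp dw d)) => s; rewrite mulr1.
Qed.

Lemma curvature_eq_reflect mu k w : curvature_eq mu k w ->
  curvature_eq mu (fun s => k (- s)) (fun s => - w (- s)).
Proof.
have d : derives (fun s : R => - s) (fun=> -1) by exact: derivesN derives_id.
case=> -[m m0 mk] dk dw; split; first by exists m.
- by apply: (derives_ext (derives_comp dk d)) => s; rewrite mulrN1.
- by apply: (derives_ext (derivesN (derives_comp dw d))) => s; rewrite mulrN1 opprK.
Qed.

Lemma curvature_eq_cst mu c : 0 < c -> (2 * c)^-1 - c + mu = 0 ->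
  curvature_eq mu (fun=> c) (fun=> 0).
Proof.
move=> c0 e; split; [by exists c|exact: derives_cst|].
by apply: (derives_ext (derives_cst 0)) => s; rewrite /accel e.
Qed.

(** Gronwall for the squared distance of the two solutions: its derivative is [-
    (k - k') (w - w') / (k k')]. *)
Lemma curvature_eq_unique mu k w k' w' :
  curvature_eq mu k w -> curvature_eq mu k' w' -> k 0 = k' 0 -> w 0 = w' 0 ->
  forall s, k s = k' s /\ w s = w' s.
Proof.
have forw k1 w1 k2 w2 s : curvature_eq mu k1 w1 -> curvature_eq mu k2 w2 ->
    k1 0 = k2 0 -> w1 0 = w2 0 -> 0 <= s -> k1 s = k2 s /\ w1 s = w2 s.
  move=> h1 h2 k0 w0 s0.
  case: (h1) => -[m m0 mk] dk dw; case: (h2) => -[m' m'0 mk'] dk' dw'.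
  pose Q s := (k1 s - k2 s) ^+ 2 + (w1 s - w2 s) ^+ 2.
  have dQ : derives Q (fun s =>
      - 1 * ((k1 s - k2 s) * (w1 s - w2 s)) * ((k1 s)^-1 * (k2 s)^-1)).
    apply: derives_ext; [rewrite /Q; derive_tac|move=> t /=].
    have := curvature_eq_gt0 t h1; have := curvature_eq_gt0 t h2.
    by rewrite /accel => ? ?; field; rewrite !gt_eqF.
  have : Q s = 0.
    apply: (gronwall0 (M := m^-1 * m'^-1) dQ s0).
    - by move=> t; rewrite addr_ge0 ?sqr_ge0.
    - by rewrite /Q k0 w0 !subrr expr0n addr0.
    - move=> t _; have p1 := curvature_eq_gt0 t h1; have p2 := curvature_eq_gt0 t h2.
      have le : (k1 t)^-1 * (k2 t)^-1 <= m^-1 * m'^-1.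
        by apply: ler_pM; rewrite ?invr_ge0 ?(ltW p1) ?(ltW p2) // lef_pV2.
      have ge : 0 < (k1 t)^-1 * (k2 t)^-1 by rewrite mulr_gt0 ?invr_gt0.
      have : - 1 * ((k1 t - k2 t) * (w1 t - w2 t)) <= Q t.
        rewrite /Q; move: (k1 t - k2 t) (w1 t - w2 t) => d e.
        have := sqr_ge0 (d + e); have := sqr_ge0 d; have := sqr_ge0 e.
        by rewrite sqrrD; lra.
      have : 0 <= Q t by rewrite addr_ge0 ?sqr_ge0.
      nra.
  move/eqP; rewrite paddr_eq0 ?sqr_ge0 // !sqrf_eq0 !subr_eq0.
  by move=> /andP[/eqP-> /eqP->].
move=> h1 h2 k0 w0 s; have [s0|/ltW s0] := leP 0 s; first exact: forw s0.
rewrite -oppr_ge0 in s0.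
have := forw _ _ _ _ _ (curvature_eq_reflect h1) (curvature_eq_reflect h2) _ _ s0.
rewrite !oppr0 !opprK k0 w0 => -[//|//|-> /eqP].
by rewrite eqr_opp => /eqP ->.
Qed.

(** Reflecting the solution at [c] gives a solution with the same initial data.
    *)
Lemma curvature_eq_sym mu k w c s : curvature_eq mu k w -> w c = 0 ->
  k (c - s) = k (c + s) /\ w (c - s) = - w (c + s).
Proof.
move=> h wc.
have h1 := curvature_eq_shift c h; have h2 := curvature_eq_reflect h1.
have := curvature_eq_unique h2 h1; rewrite /= !oppr0 !addr0 wc oppr0.
move=> /(_ erefl erefl s)[-> <-].
by rewrite opprK.
Qed.

(** Differentiating the equation once more makes it linear in [w]. *)
Lemma curvature_eq_jacobi mu k w : curvature_eq mu k w ->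
  derives (accel mu k) (fun s => - (1 + 2 * (2 * k s)^-1 ^+ 2) * w s).
Proof.
move=> h; case: (h) => _ dk dw.
have dk2 : derives (fun s => 2 * k s) (fun s => 2 * w s).
  by apply: derives_ext; [derive_tac|move=> s /=; ring].
have k0 s : 2 * k s != 0.
  by rewrite mulf_neq0 ?gt_eqF ?(curvature_eq_gt0 s h).
have := derivesV k0 dk2 => dV.
apply: derives_ext; [rewrite /accel; derive_tac|move=> s /=].
by field; have := k0 s; rewrite mulf_eq0 negb_or => /andP[].
Qed.

Lemma jacobi_coef_gt1 mu k w s : curvature_eq mu k w -> 1 < 1 + 2 * (2 * k s)^-1 ^+ 2.
Proof.
move=> h; rewrite ltrDl mulr_gt0 // exprn_gt0 // invr_gt0 mulr_gt0 //.
exact: curvature_eq_gt0 h.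
Qed.

Lemma next_critical mu k w b : curvature_eq mu k w -> w b = 0 -> 0 < accel mu k b ->
  exists a, [/\ b < a < b + pi, w a = 0, accel mu k a < 0 &
                forall s, b < s < a -> 0 < w s].
Proof.
move=> h; have [_ _ dw] := h; apply: (next_zero dw (curvature_eq_jacobi h)).
by move=> s; exact: jacobi_coef_gt1 h.
Qed.

Lemma next_critical_max mu k w b : curvature_eq mu k w -> w b = 0 ->
  accel mu k b < 0 ->
  exists a, [/\ b < a < b + pi, w a = 0, 0 < accel mu k a &
                forall s, b < s < a -> w s < 0].
Proof.
move=> h wb ab; have [_ _ dw] := h.
have d2 : derives (fun s => - accel mu k s)
    (fun s => - (1 + 2 * (2 * k s)^-1 ^+ 2) * (- w s)).
  by apply: (derives_ext (derivesN (curvature_eq_jacobi h))) => s; ring.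
have [|||a] := next_zero (b := b) (derivesN dw) d2.
- by move=> s; exact: jacobi_coef_gt1 h.
- by rewrite wb oppr0.
- by rewrite oppr_gt0.
- rewrite oppr_lt0 => -[? /eqP]; rewrite oppr_eq0 => /eqP ? ? pos.
  by exists a; split => // s /pos; rewrite oppr_gt0.
Qed.

(** By [sturm], [w] is neither positive everywhere nor negative everywhere. *)
Lemma exists_critical mu k w : curvature_eq mu k w -> exists c, w c = 0.
Proof.
move=> h; have [_ _ dw] := h; have dj := curvature_eq_jacobi h.
have q1 s := jacobi_coef_gt1 s h.
have [a wa] : exists a, w a <= 0.
  apply: contrapT => nex; apply: (sturm (b := 0) dw dj q1) => s _.
  by rewrite ltNge; apply/negP => ws; apply: nex; exists s.
have [b wb] : exists b, 0 <= w b.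
  apply: contrapT => nex; apply: (@sturm _ (fun s => - w s) (fun s => - accel mu k s)
    (fun s => 1 + 2 * (2 * k s)^-1 ^+ 2) 0); first exact: derivesN.
  - by apply: (derives_ext (derivesN dj)) => s; ring.
  - exact: q1.
  - by move=> s _; rewrite oppr_gt0 ltNge; apply/negP => ws; apply: nex; exists s.
have [ab|/ltW ab] := leP a b.
- by have [|c _ wc] := derives_ivt dw ab; [nra|exists c].
- by have [|c _ wc] := derives_ivt dw ab; [nra|exists c].
Qed.

(** The function [f = k ^ 2] satisfies [f''' + 4 f' = (2 / k + 6 mu) k'], whose
    right-hand side is negative where [k] decreases. This is tested against
    [sin (2 s)], which is positive up to [pi / 2]. *)
Lemma half_period_gt_pihalf mu k w a : curvature_eq mu k w -> 0 <= mu ->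
  w 0 = 0 -> w a = 0 -> 0 < a -> 0 < accel mu k a ->
  (forall s, 0 < s < a -> w s < 0) -> pi / 2 < a.
Proof.
move=> h mu0 w0 wa a0 aa neg; rewrite ltNge; apply/negP => ap.
have [_ dk dw] := h.
have kp s := curvature_eq_gt0 s h.
(* [F = 2 f' cos (2 s) - f'' sin (2 s)] has derivative [- (f''' + 4 f') sin (2 s)]. *)
pose F s := 4 * (k s * w s) * cos (2 * s)
  - (2 * w s ^+ 2 + 1 - 2 * k s ^+ 2 + 2 * (mu * k s)) * sin (2 * s).
have dF : derives F (fun s => - (2 * (k s)^-1 + 6 * mu) * w s * sin (2 * s)).
  apply: derives_ext; [rewrite /F; derive_tac|move=> s /=].
  by rewrite /accel; field; rewrite gt_eqF.
have : F 0 < F a.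
  apply: (derives_lt dF a0) => s /andP[s0 sa].
  have sn : 0 < sin (2 * s) by apply: sin_gt0_pi; apply/andP; split; lra.
  rewrite mulr_gt0 // -mulrNN mulr_gt0 // ?opprK ?oppr_gt0 ?neg ?s0 //.
  by have : 0 < (k s)^-1 by [rewrite invr_gt0]; nra.
rewrite /F w0 wa !(mulr0, mul0r, sin0, subr0, expr0n, add0r, sub0r) /=.
rewrite oppr0 oppr_gt0.
have -> : 1 - 2 * k a ^+ 2 + 2 * (mu * k a) = 2 * k a * accel mu k a.
  by rewrite /accel; field; rewrite gt_eqF.
have : 0 <= sin (2 * a) by apply: sin_ge0_pi; apply/andP; split; lra.
have : 0 < 2 * k a * accel mu k a by rewrite !mulr_gt0.
nra.
Qed.

(** The composite of the reflections at 0 and at [a] is the translation by [2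
    a]. *)
Lemma curvature_eq_period mu k w a : curvature_eq mu k w -> w 0 = 0 -> w a = 0 ->
  periodic k (2 * a) /\ periodic w (2 * a).
Proof.
move=> h w0 wa; split=> s.
- rewrite [s + _](_ : _ = a + (a + s)); last by ring.
  have [<- _] := curvature_eq_sym (a + s) h wa.
  rewrite opprD addrA subrr sub0r.
  by have := curvature_eq_sym s h w0; rewrite sub0r add0r => -[].
- rewrite [s + _](_ : _ = a + (a + s)); last by ring.
  apply: oppr_inj; have [_ <-] := curvature_eq_sym (a + s) h wa.
  rewrite opprD addrA subrr sub0r.
  by have := curvature_eq_sym s h w0; rewrite sub0r add0r => -[].
Qed.

(** Let [r] be the remainder of [pi] modulo the period [2 a]. Then [w (0 + pi)]
    and [w (a + pi)] are [w r] and [w (a + r)], and these have opposite signs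
    unless [r = 0] or [r = a]. *)
Lemma half_period_dvd_pi mu k w a : curvature_eq mu k w ->
  w 0 = 0 -> w a = 0 -> 0 < a < pi -> (forall s, 0 < s < a -> w s < 0) ->
  (forall c, w c = 0 -> w (c + pi) <= 0) ->
  exists2 n : nat, (1 < n)%N & pi = a * n%:R.
Proof.
move=> h w0 wa /andP[a0 ap] neg nc.
have [pk pw] := curvature_eq_period h w0 wa.
have a20 : 0 < 2 * a by rewrite mulr_gt0.
have pa0 : 0 <= pi / (2 * a) by rewrite divr_ge0 ?pi_ge0 // ltW.
pose m := Num.trunc (pi / (2 * a)); pose r := pi - (2 * a) * m%:R.
have /andP[r0 r2] : 0 <= r < 2 * a.
  have /andP[] := truncn_itv pa0; rewrite -/m ler_pdivlMr // ltr_pdivrMr //.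
  by rewrite /r -natr1 => ? ?; apply/andP; split; nra.
have piE : pi = r + (2 * a) *+ m by rewrite /r -mulr_natr; ring.
have wpi c : w (c + pi) = w (c + r).
  by rewrite piE addrA (periodicn pw).
have [ra|ra|ra] := ltgtP r a.
- have [/eqP r0'|rn0] := boolP (r == 0).
    exists (2 * m)%N; last by rewrite {1}piE r0' add0r -mulr_natr natrM; ring.
    suff : (0 < m)%N by lia.
    rewrite lt0n; apply/eqP => m0; have := @pi_gt0 R.
    by rewrite piE r0' m0 mulr0n addr0 ltxx.
  have := nc a wa; rewrite wpi.
  have [_] := curvature_eq_sym r h wa; have := neg (a - r).
  have rp : 0 < r by rewrite lt_neqAle eq_sym rn0.
  by rewrite subr_gt0 ra gtrBl rp => /(_ isT); lra.
- have := nc 0 w0; rewrite wpi add0r.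
  have [_] := curvature_eq_sym (r - a) h wa; rewrite [a + (r - a)]addrC subrK.
  by have := neg (a - (r - a)); rewrite !(subr_gt0, gtrBl) ra => h1; lra.
- exists (2 * m + 1)%N; last by rewrite {1}piE ra -mulr_natr natrD natrM; ring.
  suff : (0 < m)%N by lia.
  rewrite lt0n; apply/eqP => m0; move: ap.
  by rewrite piE ra m0 mulr0n addr0 ltxx.
Qed.

(** Start from a maximum of [k], at a distance [a] from the next critical point.
    The number [n] with [pi = n a] is at least 2, which contradicts
    [half_period_gt_pihalf] unless [mu < 0]. *)
Lemma curvature_eq_alternative mu k w : curvature_eq mu k w ->
  (forall c, w c = 0 -> w (c + pi) <= 0) ->
  (forall s, w s = 0) \/
  (mu < 0 /\ forall s, k (s + 2 * pi) = k s /\ w (s + 2 * pi) = w s).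
Proof.
move=> h nc.
have kp s := curvature_eq_gt0 s h.
have [z wz] := exists_critical h.
have [az|az] := eqVneq (accel mu k z) 0.
  left=> s; have h1 := curvature_eq_shift z h.
  have := curvature_eq_unique h1 (curvature_eq_cst (kp z) az).
  by rewrite !addr0 => /(_ erefl wz (s - z))[_]; rewrite addrC subrK.
right.
have [b [wb ab]] : exists b, w b = 0 /\ accel mu k b < 0.
  have [/(next_critical h wz)|az0|az0] := ltgtP 0 (accel mu k z).
  - by move=> [b [_ ? ? _]]; exists b.
  - by exists z.
  - by rewrite -az0 eqxx in az.
have [a' [/andP[ba ap] wa aa neg']] := next_critical_max h wb ab.
pose a := a' - b.
have a'E : a' = b + a by rewrite /a addrC subrK.
have h1 := curvature_eq_shift b h.
have neg s : 0 < s < a -> w (b + s) < 0.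
  by rewrite /a => /andP[? ?]; apply: neg'; apply/andP; split; lra.
have a0 : 0 < a by rewrite /a subr_gt0.
have w0 : w (b + 0) = 0 by rewrite addr0.
have wa1 : w (b + a) = 0 by rewrite -a'E.
have api : 0 < a < pi by rewrite a0 /a; lra.
have nc1 c : w (b + c) = 0 -> w (b + (c + pi)) <= 0.
  by move=> wc; rewrite addrA; apply: nc.
have [n n1 piE] := half_period_dvd_pi h1 w0 wa1 api neg nc1.
split.
  rewrite ltNge; apply/negP => mu0.
  have := half_period_gt_pihalf h1 mu0 w0 wa1 a0 _ neg.
  rewrite /accel -a'E => /(_ aa).
  have : 2 <= n%:R :> R by rewrite ler_nat.
  by rewrite piE; nra.
move=> s; have [pk pw] := curvature_eq_period h1 w0 wa1.
have -> : s + 2 * pi = b + ((s - b) + (2 * a) *+ n).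
  by rewrite piE -mulr_natr; ring.
by rewrite (periodicn pk) (periodicn pw) [b + _]addrC subrK.
Qed.

End CurvatureEquation.

(** * Primitives of continuous functions *)

Section Primitive.
Context {R : realType}.
Implicit Types (f df F : R -> R) (s : R).

(** The integrals from [- n] to [s], normalised to vanish at 0, are primitives
    on [s > - n] and agree where two of them are defined; near each point the
    primitive is one of them. *)
Lemma continuous_primitive f : continuous f -> exists F, derives F f.
Proof.
move=> cf.
pose I (n : nat) s := (\int[lebesgue_measure]_(t in `[(- n%:R), s]) f t)%R.
have dI n s : - n%:R < s -> is_derive s 1 (I n) (f s).
  move=> ns.
  have [||] := @continuous_FTC1_closed R f (- n%:R) s (s + 1) _ _ ns (cf s).
  - by rewrite ltrDl.
  - apply: continuous_compact_integrable; first exact: segment_compact.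
    exact: continuous_subspaceT.
  - by move=> d e; split; [exact: d|rewrite -derive1E; exact: e].
pose G n s := I n s - I n 0.
have dG n s : - n%:R < s -> is_derive s 1 (G n) (f s).
  move=> /dI h; rewrite -[f s]subr0.
  by apply: is_deriveB.
have agree n m s : (0 < n <= m)%N -> - n%:R < s -> G n s = G m s.
  move=> /andP[n0 nm] ns.
  have n0' : 0 < n%:R :> R by rewrite ltr0n.
  have nm' : n%:R <= m%:R :> R by rewrite ler_nat.
  have dH (x : R) : - n%:R < x -> is_derive x 1 (G n - G m) 0.
    move=> xn; rewrite -[0](subrr (f x)); apply: is_deriveB; apply: dG => //.
    lra.
  have H0 : (G n - G m) 0 = 0 by rewrite /G !fctE !subrr.
  apply/eqP; rewrite -subr_eq0 -[_ - _]/((G n - G m) s) -[X in _ == X]H0.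
  have cst (a b : R) : - n%:R < a -> a <= b -> (G n - G m) b = (G n - G m) a.
    move=> na ab.
    have [|| c _] := @MVT_segment R (G n - G m) (fun=> 0) a b ab.
    - by move=> x; rewrite in_itv /= => /andP[ax _]; apply: dH; lra.
    - apply: derivable_within_continuous => x; rewrite in_itv /= => /andP[ax _].
      by have [|] := dH x; first lra.
    - by rewrite mul0r => /eqP; rewrite subr_eq0 => /eqP.
  have [s0|/ltW s0] := leP 0 s; first by rewrite (cst 0 s) // oppr_lt0.
  by rewrite (cst s 0).
exists (fun s => G (Num.trunc `|s|).+1 s) => s0.
have tr (s : R) : `|s| < (Num.trunc `|s|).+1%:R by exact: truncnS_gt.
have N0 := tr s0.
apply: (@near_eq_is_derive _ _ _ (G (Num.trunc `|s0|).+2)); last first.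
  apply: dG; rewrite ltrNl; apply: (le_lt_trans (ler_norm _)).
  by rewrite normrN (lt_trans N0) // ltr_nat.
near=> s.
have hs : `|s - s0| < 1 by rewrite distrC; near: s; exists 1 => /=.
apply/esym/agree; last first.
  by rewrite ltrNl (le_lt_trans (ler_norm _)) // normrN.
rewrite /= ltnS; rewrite -ltnS.
rewrite -(@ltr_nat R); apply: (@le_lt_trans _ _ `|s|); first by rewrite truncn_le.
have := ler_normD (s - s0) s0; rewrite subrK -[(Num.trunc `|s0|).+2%:R]natr1.
lra.
Unshelve. all: by end_near. Qed.

End Primitive.

(** * The differential equation of a lambda-curve *)

Section Angle.
Context {R : realType}.

(** The lower bound on the derivative makes [f] onto the whole line. *)
Lemma derives_inverse (f df : R -> R) m : derives f df -> 0 < m ->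
  (forall s, m <= df s) ->
  exists g, [/\ cancel f g, cancel g f & derives g (fun t => (df (g t))^-1)].
Proof.
move=> h m0 mdf.
have inc a b : a < b -> f a < f b.
  by move=> ab; apply: (derives_lt h ab) => s _; exact: lt_le_trans (mdf s).
have inj : injective f.
  by move=> a b e; have [/inc|/inc|//] := ltgtP a b; rewrite e ltxx.
have growth a b : a <= b -> m * (b - a) <= f b - f a.
  move=> ab; have d : derives (fun s => f s - m * s) (fun s => df s - m).
    by apply: derives_ext; [derive_tac|move=> s /=; ring].
  suff : f a - m * a <= f b - m * b by lra.
  by apply: (derives_le d ab) => s _; rewrite subr_ge0.
have surj t : exists s, f s = t.
  pose N := (`|t| + `|f 0|) / m + 1.
  have N0 : 0 < N by rewrite ltr_wpDl // divr_ge0 ?addr_ge0 // ltW.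
  have mN : m * N = `|t| + `|f 0| + m by rewrite /N; field; rewrite gt_eqF.
  have h1 := growth 0 N (ltW N0).
  have h2 := growth (- N) 0; rewrite oppr_le0 (ltW N0) in h2.
  have {}h2 := h2 isT.
  have := ler_norm t; have := ler_norm (f 0); have := ler_norm (- t).
  have := ler_norm (- f 0); rewrite !normrN => ? ? ? ?.
  have dt : derives (fun s => f s - t) df.
    by apply: derives_ext; [derive_tac|move=> s /=; ring].
  have [| |c _ /eqP] := derives_ivt dt (a := - N) (b := N); first lra.
    by rewrite mulr_le0_ge0 //; lra.
  by rewrite subr_eq0 => /eqP; exists c.
pose g t := xget 0 [set s | f s = t].
have gK : cancel g f by move=> t; exact: (@xgetPex _ 0 [set s | f s = t] (surj t)).
have fK : cancel f g by move=> s; apply: inj; rewrite gK.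
exists g; split => // t.
rewrite -{1}[t]gK; apply: (@is_derive_inverse _ f); first by near=> s.
- by near=> s; exact: (derives_continuous h).
- exact: h.
- by rewrite gt_eqF // (lt_le_trans m0).
Unshelve. all: by end_near. Qed.

Lemma unit_angle (c s : R) : c ^+ 2 + s ^+ 2 = 1 -> exists t, cos t = c /\ sin t = s.
Proof.
move=> e; have c1 : -1 <= c <= 1.
  by have s0 := sqr_ge0 s; apply/andP; split; nra.
have sE : Num.sqrt (1 - c ^+ 2) = `|s|.
  by rewrite -sqrtr_sqr; congr Num.sqrt; lra.
have [s0|s0] := leP 0 s.
- exists (acos c); rewrite acosK ?in_itv //; split => //.
  by rewrite sin_acos // sE ger0_norm.
- exists (- acos c); rewrite cosN acosK ?in_itv //; split => //.
  by rewrite sinN sin_acos // sE ltr0_norm // opprK.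
Qed.

End Angle.

Section Flow.
Context {R : realType}.
Implicit Types (mu : R) (x y p q : R -> R).

(** The curvature with respect to the normal [(q, - p)]. *)
Definition kappa mu x y p q (s : R) : R := mu + (x s * q s - y s * p s) / 2.

Definition flow mu x y p q : Prop :=
  [/\ derives x p, derives y q,
      derives p (fun s => - kappa mu x y p q s * q s),
      derives q (fun s => kappa mu x y p q s * p s) &
      forall s, p s ^+ 2 + q s ^+ 2 = 1].

Lemma flow_shift mu x y p q c : flow mu x y p q ->
  flow mu (fun s => x (c + s)) (fun s => y (c + s))
          (fun s => p (c + s)) (fun s => q (c + s)).
Proof.
have d : derives (fun s => c + s) (fun=> 1).
  by apply: derives_ext; [derive_tac|move=> s /=; rewrite add0r].
case=> dx dy dp dq n; split => //.
- by apply: (derives_ext (derives_comp dx d)) => s; rewrite mulr1.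
- by apply: (derives_ext (derives_comp dy d)) => s; rewrite mulr1.
- by apply: (derives_ext (derives_comp dp d)) => s; rewrite mulr1.
- by apply: (derives_ext (derives_comp dq d)) => s; rewrite mulr1.
Qed.

(** Reversing the orientation changes the sign of the normal [(q, - p)], hence
    that of [mu]. *)
Lemma flow_reverse mu x y p q : flow mu x y p q ->
  flow (- mu) (fun s => x (- s)) (fun s => y (- s))
              (fun s => - p (- s)) (fun s => - q (- s)).
Proof.
have d : derives (fun s : R => - s) (fun=> -1) by exact: derivesN derives_id.
case=> dx dy dp dq n; split.
- by apply: (derives_ext (derives_comp dx d)) => s; rewrite mulrN1.
- by apply: (derives_ext (derives_comp dy d)) => s; rewrite mulrN1.
- by apply: (derives_ext (derivesN (derives_comp dp d))) => s; rewrite /kappa; ring.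
- by apply: (derives_ext (derivesN (derives_comp dq d))) => s; rewrite /kappa; ring.
- by move=> s; rewrite !sqrrN.
Qed.

(** Gronwall for the squared distance of the two solutions. With [T = (p, q)]
    and [N = (q, - p)], the difference of the normals is orthogonal to the
    difference of the tangents, so the part of the difference of the
    accelerations that is proportional to it does not contribute, and a bound on
    [(x2, y2)] over the interval suffices. *)
Lemma flow_unique mu x y p q x' y' p' q' :
  flow mu x y p q -> flow mu x' y' p' q' ->
  x 0 = x' 0 -> y 0 = y' 0 -> p 0 = p' 0 -> q 0 = q' 0 ->
  forall s, x s = x' s /\ y s = y' s.
Proof.
have forw nu x1 y1 p1 q1 x2 y2 p2 q2 s :
    flow nu x1 y1 p1 q1 -> flow nu x2 y2 p2 q2 ->
    x1 0 = x2 0 -> y1 0 = y2 0 -> p1 0 = p2 0 -> q1 0 = q2 0 ->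
    0 <= s -> x1 s = x2 s /\ y1 s = y2 s.
  move=> [dx1 dy1 dp1 dq1 n1] [dx2 dy2 dp2 dq2 n2] ex ey ep eq s0.
  pose Q s := ((x1 s - x2 s) ^+ 2 + (y1 s - y2 s) ^+ 2) +
              ((p1 s - p2 s) ^+ 2 + (q1 s - q2 s) ^+ 2).
  have dQ : derives Q (fun s =>
      2 * ((x1 s - x2 s) * (p1 s - p2 s) + (y1 s - y2 s) * (q1 s - q2 s))
      - ((x1 s - x2 s) * q1 s - (y1 s - y2 s) * p1 s
         + (x2 s * (q1 s - q2 s) - y2 s * (p1 s - p2 s)))
        * ((p1 s - p2 s) * q1 s - (q1 s - q2 s) * p1 s)).
    by apply: derives_ext; [rewrite /Q; derive_tac|move=> t /=; rewrite /kappa; field].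
  have dr : derives (fun s => x2 s ^+ 2 + y2 s ^+ 2)
     (fun s => 2 * x2 s * p2 s + 2 * y2 s * q2 s).
    by derive_tac.
  have [c _ cmax] := EVT_max s0 (derives_within dr).
  pose B := x2 c ^+ 2 + y2 c ^+ 2.
  have Q0 t : 0 <= Q t by rewrite !addr_ge0 ?sqr_ge0.
  have : Q s = 0.
    apply: (gronwall0 (M := 3 + B) dQ s0 Q0).
      by rewrite /Q ex ey ep eq !subrr !expr0n /= !addr0.
    move=> t /andP[t0 ts].
    have : x2 t ^+ 2 + y2 t ^+ 2 <= B by apply: cmax; rewrite in_itv /= !ltW.
    rewrite /Q; have := n1 t.
    move: (x1 t - x2 t) (y1 t - y2 t) (p1 t - p2 t) (q1 t - q2 t) => d d' e e'.
    move: B (x2 t) (y2 t) (p1 t) (q1 t) => {cmax}B u v p0 q0 pq uv.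
    set A := d * q0 - d' * p0; set Z := u * e' - v * e; set b := e * q0 - e' * p0.
    have hA : A ^+ 2 <= d ^+ 2 + d' ^+ 2.
      rewrite -[leRHS]mulr1 -pq /A; have := sqr_ge0 (d * p0 + d' * q0); nra.
    have hb : b ^+ 2 <= e ^+ 2 + e' ^+ 2.
      rewrite -[leRHS]mulr1 -pq /b; have := sqr_ge0 (e * p0 + e' * q0); nra.
    have hZ : Z ^+ 2 <= B * (e ^+ 2 + e' ^+ 2).
      apply: (@le_trans _ _ ((u ^+ 2 + v ^+ 2) * (e ^+ 2 + e' ^+ 2))).
        by rewrite /Z; have := sqr_ge0 (u * e + v * e'); nra.
      by apply: ler_wpM2r; rewrite ?addr_ge0 ?sqr_ge0.
    have B0 : 0 <= B by have := sqr_ge0 u; have := sqr_ge0 v; lra.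
    have hd : 0 <= B * (d ^+ 2 + d' ^+ 2) by rewrite mulr_ge0 ?addr_ge0 ?sqr_ge0.
    have he : 0 <= B * (e ^+ 2 + e' ^+ 2) by rewrite mulr_ge0 ?addr_ge0 ?sqr_ge0.
    clearbody A Z b.
    have := sqr_ge0 (A + b); have := sqr_ge0 (Z + b); rewrite !sqrrD.
    have := sqr_ge0 (d - e); have := sqr_ge0 (d' - e'); rewrite !sqrrB.
    have := sqr_ge0 d; have := sqr_ge0 d'; have := sqr_ge0 e; have := sqr_ge0 e'.
    lra.
  have := Q0; rewrite /Q => _ /eqP.
  rewrite paddr_eq0 ?addr_ge0 ?sqr_ge0 // paddr_eq0 ?sqr_ge0 // => /andP[+ _].
  by rewrite !sqrf_eq0 !subr_eq0 => /andP[/eqP-> /eqP->].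
move=> h1 h2 ex ey ep eq s; have [s0|/ltW s0] := leP 0 s.
  by apply: forw h1 h2 _ _ _ _ s0.
rewrite -oppr_ge0 in s0.
have := forw _ _ _ _ _ _ _ _ _ _ (flow_reverse h1) (flow_reverse h2) _ _ _ _ s0.
by rewrite !oppr0 !opprK ex ey ep eq; apply.
Qed.

Lemma flow_kappa mu x y p q : flow mu x y p q ->
  derives (kappa mu x y p q)
    (fun s => kappa mu x y p q s * ((x s * p s + y s * q s) / 2)).
Proof.
move=> [dx dy dp dq n].
by apply: derives_ext; [rewrite /kappa; derive_tac|move=> s /=; rewrite /kappa; ring].
Qed.

(** The equation [kappa' = kappa <x, T> / 2] of [flow_kappa] integrates to
    [kappa = E exp (|x|^2 / 4)]. *)
Lemma flow_gaussian mu x y p q s t : flow mu x y p q ->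
  kappa mu x y p q s * expR (- ((x s ^+ 2 + y s ^+ 2) / 4)) =
  kappa mu x y p q t * expR (- ((x t ^+ 2 + y t ^+ 2) / 4)).
Proof.
move=> h; have [dx dy dp dq n] := h.
apply: (derives0_cst (f := fun s =>
  kappa mu x y p q s * expR (- ((x s ^+ 2 + y s ^+ 2) / 4)))).
have dk := flow_kappa h.
by apply: derives_ext; [derive_tac|move=> r /=; field].
Qed.

(** By [flow_gaussian] the curvature, which is the speed of the angle of the
    normal, is bounded below by a positive constant, so that the angle is a
    global parameter. *)
Lemma flow_angle mu x y p q : flow mu x y p q -> 0 < kappa mu x y p q 0 ->
  exists sigma k w : R -> R,
  [/\ curvature_eq mu k w, forall s, exists t, sigma t = s,
      forall t, q (sigma t) = cos t /\ p (sigma t) = - sin t,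
      forall t, x (sigma t) = 2 * (k t - mu) * cos t - 2 * w t * sin t &
      forall t, y (sigma t) = 2 * (k t - mu) * sin t + 2 * w t * cos t].
Proof.
move=> h k0; have [dx dy dp dq n] := h.
set K := kappa mu x y p q in dp dq k0 *.
pose E := K 0 * expR (- ((x 0 ^+ 2 + y 0 ^+ 2) / 4)).
have E0 : 0 < E by rewrite mulr_gt0 ?expR_gt0.
have EK s : E <= K s.
  rewrite /E /K -(flow_gaussian s 0 h) -/K.
  have e0 : 0 < expR (- ((x s ^+ 2 + y s ^+ 2) / 4)) by exact: expR_gt0.
  have e1 : expR (- ((x s ^+ 2 + y s ^+ 2) / 4)) <= 1.
    by rewrite -[leRHS]expR0 ler_expR oppr_le0 divr_ge0 // addr_ge0 ?sqr_ge0.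
  have : 0 < K s * expR (- ((x s ^+ 2 + y s ^+ 2) / 4)).
    by rewrite /K (flow_gaussian s 0 h).
  by rewrite pmulr_lgt0 // => Ks; rewrite ger_pMr.
have dK : derives K (fun s => K s * ((x s * p s + y s * q s) / 2)) by exact: flow_kappa.
have [F dF] := continuous_primitive (derives_continuous dK).
have [a [ca sa]] : exists t, cos t = q 0 /\ sin t = - p 0.
  by apply: unit_angle; rewrite sqrrN addrC.
pose th s := F s - F 0 + a.
have dth : derives th K by apply: derives_ext; [rewrite /th; derive_tac|move=> s /=; ring].
(* The unit vectors [(q, - p)] and [(cos th, sin th)] have constant inner product 1. *)
have qp s : q s = cos (th s) /\ p s = - sin (th s).
  have dC : derives (fun s => q s * cos (th s) - p s * sin (th s)) (fun=> 0).
    by apply: derives_ext; [derive_tac|move=> r /=; ring].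
  have := derives0_cst dC s 0; rewrite {3 4}/th subrr add0r ca sa => e.
  have := n 0; have := n s; have := cos2Dsin2 (th s) => e1 e2 e3.
  have : (q s - cos (th s)) ^+ 2 + (p s + sin (th s)) ^+ 2 = 0 by rewrite sqrrB sqrrD; lra.
  move/eqP; rewrite paddr_eq0 ?sqr_ge0 // !sqrf_eq0 subr_eq0 addr_eq0.
  by move=> /andP[/eqP-> /eqP->].
have [g [fK gK dg]] := derives_inverse dth E0 EK.
exists g, (fun t => K (g t)), (fun t => (x (g t) * p (g t) + y (g t) * q (g t)) / 2).
have qpg t : q (g t) = cos t /\ p (g t) = - sin t by have := qp (g t); rewrite gK.
split => //.
- split; first by exists E.
  + apply: (derives_ext (derives_comp dK dg)) => t /=.
    by field; rewrite gt_eqF // (lt_le_trans E0).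
  + have d1 : derives (fun s => (x s * p s + y s * q s) / 2)
       (fun s => (1 - 2 * K s * (K s - mu)) / 2).
      apply: derives_ext; [derive_tac|move=> s /=].
      transitivity ((p s ^+ 2 + q s ^+ 2 - 2 * K s * (K s - mu)) / 2).
        by rewrite /K /kappa; field.
      by rewrite n.
    apply: (derives_ext (derives_comp d1 dg)) => t /=.
    by rewrite /accel; field; rewrite gt_eqF // (lt_le_trans E0).
- by move=> s; exists (th s).
- move=> t; have := n (g t); have [<- e] := qpg t; rewrite /K /kappa.
  have -> : sin t = - p (g t) by rewrite e opprK.
  move: (x _) (y _) (p _) (q _) => X Y P Q' e1.
  by transitivity (X * (P ^+ 2 + Q' ^+ 2)); [rewrite e1 mulr1|field].
- move=> t; have := n (g t); have [<- e] := qpg t; rewrite /K /kappa.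
  have -> : sin t = - p (g t) by rewrite e opprK.
  move: (x _) (y _) (p _) (q _) => X Y P Q' e1.
  by transitivity (Y * (P ^+ 2 + Q' ^+ 2)); [rewrite e1 mulr1|field].
Qed.

End Flow.

(** * Arclength parametrizations *)

Section Curve.
Context {R : realType}.
Implicit Types (lambda : R) (g : set 'rV[R]_2) (n : 'rV[R]_2 -> 'rV[R]_2)
  (c : R -> 'rV[R]_2).

Lemma dotE (u v : 'rV[R]_2) : dot u v = u 0 0 * v 0 0 + u 0 1 * v 0 1.
Proof.
rewrite /dot !big_ord_recl big_ord0 addr0.
by congr (_ * _ + _ * _); congr fun_of_matrix; apply/val_inj.
Qed.

Lemma rV2P (u v : 'rV[R]_2) : u 0 0 = v 0 0 -> u 0 1 = v 0 1 -> u = v.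
Proof.
move=> h0 h1; apply/rowP => i; have [/eqP->|/eqP->] : i == 0 \/ i == 1 => //.
by case: i => -[|[|//]] hi; [left|right].
Qed.

Lemma smooth_coord c k i : smooth c ->
  derives (fun s => derive1n k c s 0 i) (fun s => derive1n k.+1 c s 0 i).
Proof.
move=> sc s; have h := sc k s.
apply: DeriveDef; first exact: (derivable_mxP _ _ _).1 h 0 i.
by rewrite derive1nS derive1E derive_mx // mxE.
Qed.

Lemma arclength_continuous g c : arclength_param g c -> continuous c.
Proof.
case=> sc _ _ s; apply/differentiable_continuous/derivable1_diffP.
exact: sc 0%N s.
Qed.

Lemma continuous_into (T U : topologicalType) (f : R -> T) (A : set T) (h : T -> U) :
  continuous f -> (forall s, A (f s)) -> {within A, continuous h} ->
  continuous (fun s => h (f s)).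
Proof.
move=> cf Af /subspace_continuousP ch s.
apply: cvg_trans (ch _ (Af s)) => W hW /=.
have {}hW : nbhs s [set t | A (f t) -> W (h (f t))] by exact: (cf s _ hW).
have : nbhs s [set t | W (h (f t))] by apply: filterS hW => t; apply; exact: Af.
by [].
Qed.

Definition curve_flow (mu : R) c : Prop :=
  flow mu (fun s => c s 0 0) (fun s => c s 0 1)
    (fun s => derive1 c s 0 0) (fun s => derive1 c s 0 1).

(** The normal is a multiple of [(q, - p)] by a continuous factor of square 1,
    hence by a constant sign. *)
Lemma arclength_flow lambda g n c : unit_normal g n -> lambda_curve lambda g n ->
  arclength_param g c ->
  exists e : R, [/\ e ^+ 2 = 1, curve_flow (e * lambda) c &
    forall s, n (c s) 0 0 = e * derive1 c s 0 1 /\ n (c s) 0 1 = - (e * derive1 c s 0 0)].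
Proof.
move=> [nc n1 no] lc hc; have [sc gc uc] := hc.
have cc := arclength_continuous hc.
set p := fun s => derive1 c s 0 0; set q := fun s => derive1 c s 0 1.
have dx : derives (fun s => c s 0 0) p by exact: (smooth_coord 0 0 sc).
have dy : derives (fun s => c s 0 1) q by exact: (smooth_coord 0 1 sc).
pose p' s := derive1n 2 c s 0 0; pose q' s := derive1n 2 c s 0 1.
have dp : derives p p' by exact: (smooth_coord 1 0 sc).
have dq : derives q q' by exact: (smooth_coord 1 1 sc).
have pq s : p s ^+ 2 + q s ^+ 2 = 1 by have := uc s; rewrite dotE -!expr2.
pose f s := n (c s) 0 0 * q s - n (c s) 0 1 * p s.
have nE s : n (c s) 0 0 = f s * q s /\ n (c s) 0 1 = - (f s * p s).
  have := no c sc gc s; rewrite dotE -/(p s) -/(q s) /f; have := pq s.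
  move: (n (c s) 0 0) (n (c s) 0 1) (p s) (q s) => a b u v uv1 ort; split.
  - transitivity (a * (u ^+ 2 + v ^+ 2) - u * (u * a + v * b)); last by ring.
    by rewrite uv1 ort; ring.
  - transitivity (b * (u ^+ 2 + v ^+ 2) - v * (u * a + v * b)); last by ring.
    by rewrite uv1 ort; ring.
have f2 s : f s ^+ 2 = 1.
  have := n1 _ (gc s); rewrite dotE; have [-> ->] := nE s => <-.
  transitivity (f s ^+ 2 * (p s ^+ 2 + q s ^+ 2)); first by rewrite pq mulr1.
  by ring.
have cnc := continuous_into cc gc nc.
have cf : continuous f.
  have ci i : continuous (fun s => n (c s) 0 i).
    move=> s; apply: (@continuous_comp _ _ _ (fun s => n (c s)) (fun M : 'rV[R]_2 => M 0 i)).
      exact: cnc.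
    exact: coord_continuous.
  move=> s; rewrite /f; apply: cvgB; apply: cvgM; try exact: ci.
    exact: (derives_continuous dq).
  exact: (derives_continuous dp).
have f0 s : f s != 0 by rewrite -sqrf_eq0 f2 oner_neq0.
have fcst s : f s = f 0.
  have le a b : a <= b -> f a = f b.
    move=> ab; apply/eqP; apply: contrapT => /negP ne.
    have fab : f a = - f b.
      have /eqP := etrans (f2 a) (esym (f2 b)).
      by rewrite eqf_sqr (negbTE ne) => /eqP.
    have [|t _ ft] := IVT ab (continuous_subspaceT cf) (v := 0).
      by rewrite fab ge_min le_max !oppr_le0 !oppr_ge0;
        have [h|/ltW h] := leP 0 (f b); rewrite ?h ?orbT.
    by have := f0 t; rewrite ft eqxx.
  by have [s0|/ltW s0] := leP 0 s; [rewrite (le 0 s)|rewrite (le s 0)].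
exists (f 0); split; [exact: f2| |by move=> s; rewrite -(fcst s); exact: nE].
have ort s : p s * p' s + q s * q' s = 0.
  have d : derives (fun s => p s ^+ 2 + q s ^+ 2)
      (fun s => 2 * p s * p' s + 2 * q s * q' s).
    by derive_tac.
  have := derives_unique d (df := _) (dg := fun=> 0).
  move=> /(_ _ s) h; have {h} : 2 * p s * p' s + 2 * q s * q' s = 0.
    by apply: h; under eq_fun do rewrite pq; exact: derives_cst.
  lra.
have curv s : kappa (f 0 * lambda) (fun s => c s 0 0) (fun s => c s 0 1) p q s
    = p s * q' s - q s * p' s.
  have := lc c hc s; rewrite /curvature /kappa !dotE -/(p' s) -/(q' s).
  have [-> ->] := nE s; rewrite (fcst s) => <-.
  have := f2 0.
  move: (f 0) (c s 0 0) (c s 0 1) (p s) (q s) (p' s) (q' s) => e x y u v u' v' e2.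
  transitivity ((u * v' - v * u') * e ^+ 2 + (x * v - y * u) / 2 * (1 - e ^+ 2)); first by field.
  by rewrite e2; field.
split; [exact: dx|exact: dy| | |exact: pq].
- apply: (derives_ext dp) => s; rewrite curv -/(q s).
  transitivity (p' s * (p s ^+ 2 + q s ^+ 2) - p s * (p s * p' s + q s * q' s)).
    by rewrite pq ort; ring.
  by ring.
- apply: (derives_ext dq) => s; rewrite curv -/(p s).
  transitivity (q' s * (p s ^+ 2 + q s ^+ 2) - q s * (p s * p' s + q s * q' s)).
    by rewrite pq ort; ring.
  by ring.
Qed.

(** The normals at the common point agree, so that the tangents are equal or
    opposite. After reversing one of the parametrizations in the second case,
    both solve the same equation with the same initial data. *)
Lemma arclength_meet lambda g n c1 c2 s1 s2 :
  unit_normal g n -> lambda_curve lambda g n ->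
  arclength_param g c1 -> arclength_param g c2 -> c1 s1 = c2 s2 ->
  forall s, range c2 (c1 s).
Proof.
move=> hn hl h1 h2 e12 s.
have [e1 [e1s f1 n1]] := arclength_flow hn hl h1.
have [e2 [e2s f2 n2]] := arclength_flow hn hl h2.
have [m1 m2] := n1 s1; have [m3 m4] := n2 s2.
rewrite e12 in m1 m2; rewrite {}m1 in m3; rewrite {}m2 in m4.
have e1n0 : e1 != 0 by rewrite -sqrf_eq0 e1s oner_neq0.
have g1 := flow_shift s1 f1; have g2 := flow_shift s2 f2.
have /eqP : e1 ^+ 2 = e2 ^+ 2 by rewrite e1s.
rewrite eqf_sqr => /orP[] /eqP ee.
- rewrite -{}ee in f2 g2 m3 m4; have := flow_unique g1 g2; rewrite !addr0 e12.
  move=> /(_ erefl erefl).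
  rewrite (mulfI e1n0 m3) (mulfI e1n0 (oppr_inj m4)) => /(_ erefl erefl (s - s1)).
  rewrite addrC subrK => -[h h']; exists (s2 + (s - s1)) => //.
  by apply: rV2P; rewrite ?h ?h'.
- have {ee} ee : e2 = - e1 by rewrite ee opprK.
  rewrite {}ee in f2 g2 m3 m4; have := flow_unique g1; move: (flow_reverse g2).
  rewrite mulNr opprK => {}g2 /(_ _ _ _ _ g2); rewrite !oppr0 !addr0 e12.
  move=> /(_ erefl erefl).
  have -> : derive1 c1 s1 0 1 = - derive1 c2 s2 0 1 by apply: (mulfI e1n0); lra.
  have -> : derive1 c1 s1 0 0 = - derive1 c2 s2 0 0 by apply: (mulfI e1n0); lra.
  move=> /(_ erefl erefl (s - s1)).
  rewrite addrC subrK => -[h h']; exists (s2 - (s - s1)) => //.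
  by apply: rV2P; rewrite ?h ?h'.
Qed.

(** The component of the curve along its tangent at [s0] is strictly increasing
    near [s0]. *)
Lemma arclength_locally_injective g c s0 : arclength_param g c ->
  exists2 d, 0 < d & forall s t, s0 - d <= s <= s0 + d -> s0 - d <= t <= s0 + d ->
    c s = c t -> s = t.
Proof.
move=> [sc _ uc].
set p := fun s => derive1 c s 0 0; set q := fun s => derive1 c s 0 1.
have dx : derives (fun s => c s 0 0) p by exact: (smooth_coord 0 0 sc).
have dy : derives (fun s => c s 0 1) q by exact: (smooth_coord 0 1 sc).
have dp : derives p (fun s => derive1n 2 c s 0 0) by exact: (smooth_coord 1 0 sc).
have dq : derives q (fun s => derive1n 2 c s 0 1) by exact: (smooth_coord 1 1 sc).
have pq s : p s * p s + q s * q s = 1 by have := uc s; rewrite dotE.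
clearbody p q.
have ch : continuous (fun s => p s * p s0 + q s * q s0).
  by apply: derives_continuous; derive_tac.
have df : derives (fun s => c s 0 0 * p s0 + c s 0 1 * q s0)
   (fun s => p s * p s0 + q s * q s0).
  by apply: derives_ext; [derive_tac|move=> s /=; ring].
have /cvgrPdist_lt/(_ _ ltr01)[d /= d0 hd] := ch s0.
exists (d / 2); first by rewrite divr_gt0.
have mono s t : s0 - d / 2 <= s -> t <= s0 + d / 2 -> s < t -> c s <> c t.
  move=> hs ht st e.
  have := derives_lt df st; rewrite e ltxx => h.
  suff : false by [].
  apply: h => r /andP[sr rt].
  have : `|1 - (p r * p s0 + q r * q s0)| < 1.
    by rewrite -{1}(pq s0); apply: hd; rewrite /= ltr_distl; apply/andP; split; lra.
  by rewrite ltr_norml => /andP[_]; lra.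
move=> s t /andP[hs hs'] /andP[ht ht'] e.
have [st|ts|//] := ltgtP s t; [by case: (mono s t)|by case: (mono t s)].
Qed.

(** Read in a chart, the parametrization is a continuous injective real function
    near [s0], hence strictly monotonic, and the intermediate value theorem
    shows that its image contains a neighbourhood. *)
Lemma arclength_open g c s0 : embedded_curve g -> arclength_param g c ->
  \forall z \near c s0, g z -> range c z.
Proof.
move=> emb hc; have [_ gc _] := hc; have cc := arclength_continuous hc.
have [V [a [b [[oV Vc] _ ra ab /subspace_continuousP cb]]]] := emb _ (gc s0).
have [d d0 inj] := arclength_locally_injective s0 hc.
have [e e0 he] : exists2 e, 0 < e & forall s, `|s0 - s| < e -> V (c s).
  have [e /= e0 he] : nbhs s0 (c @^-1` V) by apply: cc; exact: open_nbhs_nbhs.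
  by exists e.
pose r := Num.min d (e / 2).
have r0 : 0 < r by rewrite lt_min d0 divr_gt0.
have rd : r <= d by rewrite ge_min lexx.
have re : r < e by rewrite (@le_lt_trans _ _ (e / 2)) ?ge_min ?lexx ?orbT //; lra.
pose I := `[s0 - r, s0 + r]%R.
have IV s : s \in I -> V (c s).
  rewrite /I in_itv /= => /andP[h1 h2]; apply: he.
  by rewrite distrC ltr_distl; apply/andP; split; lra.
have aK z : g z -> V z -> a (b z) = z.
  move=> gz Vz; have : range a z by rewrite ra.
  by case=> t _ <-; rewrite ab.
have tc : {within [set` I], continuous (fun s => b (c s))}.
  apply/subspace_continuousP => s sI.
  apply: cvg_trans (cb (c s) _); last by split; [exact: gc|exact: IV].
  move=> W hW /=.
  have {}hW : nbhs s [set t | (g `&` V) (c t) -> W (b (c t))] by exact: (cc s _ hW).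
  have : nbhs s [set t | t \in I -> W (b (c t))].
    by apply: filterS hW => t h tI; apply: h; split; [exact: gc|exact: IV].
  by [].
have tinj : {in I &, injective (fun s => b (c s))}.
  move=> s t sI tI /(congr1 a); rewrite !aK //; try exact: IV.
  move: sI tI; rewrite /I !in_itv /= => /andP[? ?] /andP[? ?].
  by apply: inj; apply/andP; split; lra.
have lI : s0 - r \in I by rewrite /I in_itv /= lexx /=; lra.
have rI : s0 + r \in I by rewrite /I in_itv /= lexx andbT; lra.
have mI : s0 \in I by rewrite /I in_itv /=; apply/andP; split; lra.
have [l [u [hl hu lu]]] : exists l u, [/\ l < b (c s0), b (c s0) < u &
   forall y, l < y < u -> Num.min (b (c (s0 - r))) (b (c (s0 + r))) <= y <=
     Num.max (b (c (s0 - r))) (b (c (s0 + r)))].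
  have [mono|mono] := itv_continuous_inj_mono tc tinj.
  - exists (b (c (s0 - r))), (b (c (s0 + r))); split.
    + by apply: mono => //; lra.
    + by apply: mono => //; lra.
    + by move=> y /andP[y1 y2]; rewrite ge_min le_max (ltW y1) (ltW y2) orbT.
  - exists (b (c (s0 + r))), (b (c (s0 - r))); split.
    + by apply: mono => //; lra.
    + by apply: mono => //; lra.
    + by move=> y /andP[y1 y2]; rewrite ge_min le_max (ltW y1) (ltW y2) orbT.
have hb : \forall z \near c s0, (g `&` V) z -> l < b z < u.
  have : nbhs (b (c s0)) [set y | l < y < u].
    near=> y; apply/andP; split; near: y; [exact: lt_nbhsr|exact: lt_nbhsl].
  exact: (cb (c s0) (conj (gc s0) Vc)).
have hV : \forall z \near c s0, V z by exact: open_nbhs_nbhs.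
near=> z => gz.
have Vz : V z by near: z.
have bz : l < b z < u by move: gz Vz => ? ?; apply: (near hb z).
have [|s sI bs] := IVT _ tc (lu _ bz); first lra.
exists s => //; rewrite -(aK z) // -bs aK //; exact: IV.
Unshelve. all: by end_near. Qed.

Lemma range_arclength lambda g n c :
  connected g -> embedded_curve g -> complete_curve g ->
  unit_normal g n -> lambda_curve lambda g n -> arclength_param g c -> range c = g.
Proof.
move=> conn emb compl hn hl hc; have [_ gc _] := hc.
apply: conn; first by exists (c 0), 0.
- exists (interior [set z | g z -> range c z]); first exact: open_interior.
  apply/seteqP; split => [_ [s _ <-]|z [gz /interior_subset]]; last exact.
  by split; [exact: gc|exact: arclength_open].
(* If [range c] accumulates at [z], it meets the open image of the
   parametrization through [z], hence contains [z]. *)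
- exists (~` (interior [set z | g z -> ~ range c z])).
    by apply: open_closedC; exact: open_interior.
  apply/seteqP; split => [_ [s _ <-]|z [gz nz]].
    by split; [exact: gc|move=> /interior_subset /(_ (gc s)); apply; exists s].
  apply: contrapT => ncz; apply: nz.
  have [cz hz cz0] := compl z gz.
  have := arclength_open 0 emb hz; rewrite cz0; apply: filterS => y hy gy [s _ sy].
  have [t _ ty] := hy gy; apply: ncz.
  by rewrite -cz0; apply: (arclength_meet hn hl hz hc (s1 := t) (s2 := s)); rewrite ty sy.
Qed.

End Curve.

(** * Closing up of the curve *)

Section Closing.
Context {R : realType}.
Implicit Types (mu r : R) (g : set 'rV[R]_2) (n : 'rV[R]_2 -> 'rV[R]_2)
  (k w : R -> R).

Definition vec2 (a b : R) : 'rV[R]_2 := \row_(i < 2) (if i == 0 then a else b).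

Lemma vec20 a b : vec2 a b 0 0 = a. Proof. by rewrite mxE. Qed.
Lemma vec21 a b : vec2 a b 0 1 = b. Proof. by rewrite mxE. Qed.

Lemma vec2_eta (z : 'rV[R]_2) : z = vec2 (z 0 0) (z 0 1).
Proof. by apply: rV2P; rewrite ?vec20 ?vec21. Qed.

Lemma vec2_continuous (f h : R -> R) df dh : derives f df -> derives h dh ->
  continuous (fun s => vec2 (f s) (h s)).
Proof.
move=> df' dh' s; apply/differentiable_continuous/derivable1_diffP.
apply/derivable_mxP => i j; rewrite (_ : (fun x => _) = if j == 0 then f else h).
  by case: ifP => _; [have [] := df' s|have [] := dh' s].
by apply/funext => x; rewrite mxE; case: ifP.
Qed.

(** The coordinates of [2 (k - mu) N + 2 w T], where [N = (cos t, sin t)] and [T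
    = (- sin t, cos t)]. *)
Definition angle_x mu k w t := 2 * (k t - mu) * cos t - 2 * w t * sin t : R.
Definition angle_y mu k w t := 2 * (k t - mu) * sin t + 2 * w t * cos t : R.

Lemma derives_angle_x mu k w : curvature_eq mu k w ->
  derives (angle_x mu k w) (fun t => - sin t / k t).
Proof.
move=> h; have [_ dk dw] := h.
apply: derives_ext; [rewrite /angle_x; derive_tac|move=> t /=].
by rewrite /accel; field; rewrite gt_eqF // (curvature_eq_gt0 t h).
Qed.

Lemma derives_angle_y mu k w : curvature_eq mu k w ->
  derives (angle_y mu k w) (fun t => cos t / k t).
Proof.
move=> h; have [_ dk dw] := h.
apply: derives_ext; [rewrite /angle_y; derive_tac|move=> t /=].
by rewrite /accel; field; rewrite gt_eqF // (curvature_eq_gt0 t h).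
Qed.

(** The component of the curve orthogonal to its axis of symmetry at [c] has
    derivative [cos t / k]: it is positive at [t = pi / 2], and equal to [- 2 w
    (c + pi)] at [t = pi]. Where it vanishes the curve meets its mirror image,
    with a different normal. *)
Lemma no_crossing mu k w c : curvature_eq mu k w ->
  (forall s t, angle_x mu k w s = angle_x mu k w t ->
     angle_y mu k w s = angle_y mu k w t -> cos s = cos t /\ sin s = sin t) ->
  w c = 0 -> w (c + pi) <= 0.
Proof.
move=> h inj wc; rewrite leNgt; apply/negP => wp.
have h1 := curvature_eq_shift c h.
pose f := angle_y mu (fun s => k (c + s)) (fun s => w (c + s)).
have df : derives f _ := derives_angle_y h1.
have p0 := @pi_gt0 R.
have f0 : f 0 = 0 by rewrite /f /angle_y sin0 addr0 wc; ring.
have fp : f pi < 0 by rewrite /f /angle_y sinpi cospi; lra.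
have fh : 0 < f (pi / 2).
  rewrite -f0; apply: (derives_lt df); first by rewrite divr_gt0.
  move=> s /andP[s0 sp]; rewrite divr_gt0 ?(curvature_eq_gt0 _ h) //.
  by apply: cos_gt0_pihalf; apply/andP; split; lra.
have [||t /andP[t1 t2] ft] := derives_ivt df (a := pi / 2) (b := pi); [lra|nra|].
have st : 0 < sin t.
  apply: sin_gt0_pi; apply/andP; split; first lra.
  rewrite lt_neqAle t2 andbT; apply/eqP => tp.
  by move: fp; rewrite -tp ft ltxx.
have [ks ws] := curvature_eq_sym t h wc.
have [cE sE] : cos (c - t) = cos (c + t) /\ sin (c - t) = sin (c + t).
  move: ft; rewrite /f /angle_y => ft.
  apply: inj; rewrite /angle_x /angle_y ks ws cosB cosD sinB sinD.
  - transitivity ((2 * (k (c + t) - mu) * (cos c * cos t - sin c * sin t) -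
       2 * w (c + t) * (sin c * cos t + cos c * sin t)) + 2 * sin c *
      (2 * (k (c + t) - mu) * sin t + 2 * w (c + t) * cos t)); first by ring.
    by rewrite ft; ring.
  - transitivity ((2 * (k (c + t) - mu) * (sin c * cos t + cos c * sin t) +
       2 * w (c + t) * (cos c * cos t - sin c * sin t)) - 2 * cos c *
      (2 * (k (c + t) - mu) * sin t + 2 * w (c + t) * cos t)); first by ring.
    by rewrite ft; ring.
move: cE sE; rewrite cosB cosD sinB sinD => cE sE.
have cc : cos c * sin t = 0 by lra.
have ss : sin c * sin t = 0 by lra.
have := cos2Dsin2 c => e.
have : sin t = (cos c ^+ 2 + sin c ^+ 2) * sin t by rewrite e mul1r.
move=> e2; have : sin t = cos c * (cos c * sin t) + sin c * (sin c * sin t).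
  by rewrite {1}e2; ring.
by rewrite cc ss; lra.
Qed.

(** The representative [t'] does not depend on the function, so that it can be
    used for several functions of the same period at once. *)
Lemma periodic_window (T t : R) : 0 < T -> exists2 t', 0 <= t' <= T &
  forall f : R -> R, periodic f T -> f t' = f t.
Proof.
move=> T0; pose N := (Num.trunc (`|t| / T)).+1.
have tN : `|t| < T * N%:R by rewrite mulrC -ltr_pdivrMr // truncnS_gt.
have t0 : 0 <= t + T *+ N by have := ler_norm (- t); rewrite normrN -mulr_natr; lra.
have q0 : 0 <= (t + T *+ N) / T by rewrite divr_ge0 // ltW.
pose m := Num.trunc ((t + T *+ N) / T).
have /andP[m1 m2] := truncn_itv q0; rewrite -/m in m1 m2.
rewrite ler_pdivlMr // in m1; rewrite ltr_pdivrMr // -natr1 mulrDl mul1r in m2.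
exists (t + T *+ N - T *+ m).
  by rewrite -(mulr_natl T m); apply/andP; split; lra.
by move=> f pf; rewrite -(periodicn pf m) subrK (periodicn pf).
Qed.

Lemma periodic_angle mu k w : periodic k (2 * pi) -> periodic w (2 * pi) ->
  periodic (angle_x mu k w) (2 * pi) /\ periodic (angle_y mu k w) (2 * pi).
Proof.
have pE : 2 * pi = pi *+ 2 :> R by rewrite -[RHS]mulr_natl.
move=> pk pw; split=> s; rewrite /angle_x /angle_y pk pw pE;
  by rewrite (sinD2pi s) (cosD2pi s).
Qed.

(** The squared distance to the origin has derivative [4 w / k], so its maximum
    is at a critical point of [k] where [accel <= 0], that is [k - mu >= 1 / (2
    k)]. *)
Lemma exists_farthest mu k w : curvature_eq mu k w ->
  periodic k (2 * pi) -> periodic w (2 * pi) ->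
  exists t0, [/\ 0 < k t0 - mu, w t0 = 0 &
    forall t, angle_x mu k w t ^+ 2 + angle_y mu k w t ^+ 2 <= (2 * (k t0 - mu)) ^+ 2].
Proof.
move=> h pk pw; have [_ dk dw] := h.
pose r t := 4 * ((k t - mu) ^+ 2 + w t ^+ 2).
have dr : derives r (fun t => 4 * w t / k t).
  apply: derives_ext; [rewrite /r; derive_tac|move=> t /=].
  by rewrite /accel; field; rewrite gt_eqF // (curvature_eq_gt0 t h).
have rE t : angle_x mu k w t ^+ 2 + angle_y mu k w t ^+ 2 = r t.
  rewrite /angle_x /angle_y /r.
  transitivity (4 * ((k t - mu) ^+ 2 + w t ^+ 2) * (cos t ^+ 2 + sin t ^+ 2)).
    by ring.
  by rewrite cos2Dsin2 mulr1.
have p20 : 0 < 2 * pi :> R by rewrite mulr_gt0 ?pi_gt0.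
have [t0 _ tmax] := EVT_max (ltW p20) (derives_within dr).
have rmax t : r t <= r t0.
  have [t' t'i e] := periodic_window t p20.
  have <- : r t' = r t by apply: e => s; rewrite /r pk pw.
  by apply: tmax; rewrite in_itv.
have k0 := curvature_eq_gt0 t0 h.
have wt0 : w t0 = 0.
  have [] := @derive1_at_max _ r (t0 - 1) (t0 + 1) t0.
  - lra.
  - by move=> t _; have [] := dr t.
  - by rewrite in_itv /=; apply/andP; split; lra.
  - by move=> t _; exact: rmax.
  have [_ ->] := dr t0; move=> _ /eqP.
  by rewrite mulf_eq0 invr_eq0 (gt_eqF k0) orbF mulf_eq0 pnatr_eq0 /= => /eqP.
have a0 : accel mu k t0 <= 0.
  rewrite leNgt; apply/negP => a0.
  have [d d0 pos] := derives_pos_right dw (curvature_eq_jacobi h) wt0 a0.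
  have : r t0 < r (t0 + d).
    apply: (derives_lt dr); first by rewrite ltrDl.
    move=> s /andP[s1 s2]; rewrite divr_gt0 ?(curvature_eq_gt0 _ h) // mulr_gt0 //.
    by apply: pos; rewrite s1 ltW.
  by rewrite ltNge rmax.
exists t0; split => //.
  have : 0 < (2 * k t0)^-1 by rewrite invr_gt0 mulr_gt0.
  by move: a0; rewrite /accel; lra.
move=> t; rewrite rE; apply: (le_trans (rmax t)).
by rewrite /r wt0 expr0n /= addr0 exprMn; lra.
Qed.

Lemma coord_le_norm (z : 'rV[R]_2) i : `|z 0 i| <= `|z|.
Proof.
rewrite [leRHS]/Num.Def.normr /= mx_normrE.
exact: (@le_bigmax _ _ _ 0 (fun j : 'I_1 * 'I_2 => `|z j.1 j.2|) (0, i)).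
Qed.

(** The ray from this point away from the origin avoids [g] and is unbounded. *)
Lemma not_enclosed_ray g (c s r : R) : c ^+ 2 + s ^+ 2 = 1 ->
  (forall z, g z -> z 0 0 ^+ 2 + z 0 1 ^+ 2 < r ^+ 2) -> 0 < r ->
  ~ enclosed g (vec2 (r * c) (r * s)).
Proof.
move=> cs gr r0 [_ bd].
pose f (u : R) := vec2 (u * c) (u * s).
have cf : continuous f.
  apply: vec2_continuous; exact: (derivesM derives_id (derives_cst _)).
pose A := f @` `[r, +oo[.
have cA : connected A.
  apply: connected_continuous_connected; last exact: continuous_subspaceT.
  exact/connected_intervalP/interval_is_interval.
have AB : A `<=` connected_component (~` g) (f r).
  apply: connected_component_max => //.
  - by exists r => //=; rewrite in_itv /= lexx.
  - move=> _ [u + <-] => /=; rewrite in_itv /= andbT => ru /gr.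
    rewrite vec20 vec21.
    have -> : (u * c) ^+ 2 + (u * s) ^+ 2 = u ^+ 2 * (c ^+ 2 + s ^+ 2).
      by ring.
    by rewrite cs mulr1; nra.
have [M [_ hM]] := bd.
pose M' := `|M| + 1; have M0 : 0 < M' by rewrite ltr_wpDl.
have {hM} hM u : r <= u -> `|f u| <= M'.
  move=> ru; apply: (hM M').
    by have := ler_norm M; rewrite /M'; lra.
  by apply: AB; exists u => //=; rewrite in_itv /= ru.
pose u := r + 2 * M'.
have fu : `|f u| <= M' by apply: hM; rewrite /u; lra.
have h0 := le_trans (coord_le_norm (f u) 0) fu.
have h1 := le_trans (coord_le_norm (f u) 1) fu.
rewrite /f vec20 in h0; rewrite /f vec21 in h1.
have s0 : (u * c) ^+ 2 <= M' ^+ 2.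
  by rewrite -real_normK ?num_real // ler_sqr ?nnegrE // ltW.
have s1 : (u * s) ^+ 2 <= M' ^+ 2.
  by rewrite -real_normK ?num_real // ler_sqr ?nnegrE // ltW.
have : u ^+ 2 <= 2 * M' ^+ 2.
  have -> : u ^+ 2 = (u * c) ^+ 2 + (u * s) ^+ 2.
    by rewrite -[LHS]mulr1 -cs; ring.
  lra.
rewrite /u; nra.
Qed.

(** With [w = 0] the position is [N / k], which describes the circle of radius
    [1 / k]. The other alternative requires [e = - 1], and contradicts the
    direction of the normal on a compact curve. *)
Lemma angle_curve_circle lambda e g n k w : 0 <= lambda -> e ^+ 2 = 1 ->
  curvature_eq (e * lambda) k w ->
  (forall z, g z <-> exists t,
     z = vec2 (angle_x (e * lambda) k w t) (angle_y (e * lambda) k w t)) ->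
  (forall t, n (vec2 (angle_x (e * lambda) k w t) (angle_y (e * lambda) k w t)) =
     vec2 (e * cos t) (e * sin t)) ->
  (compact g -> outward_pointing g n) -> is_round_circle g.
Proof.
set mu := e * lambda => l0 e2 h gE nE out.
have en0 : e != 0 by rewrite -sqrf_eq0 e2 oner_neq0.
have inj s t : angle_x mu k w s = angle_x mu k w t ->
     angle_y mu k w s = angle_y mu k w t -> cos s = cos t /\ sin s = sin t.
  move=> ex ey; have := nE s; rewrite ex ey nE => E.
  have := congr1 (fun z : 'rV_2 => z 0 0) E.
  have := congr1 (fun z : 'rV_2 => z 0 1) E.
  by rewrite !vec20 !vec21 => /(mulfI en0) -> /(mulfI en0) ->.
have [w0|[mu0 per]] := curvature_eq_alternative h (fun c => no_crossing h inj).
- have [_ dk dw] := h.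
  have kE t : k t = k 0.
    by apply: derives0_cst; apply: (derives_ext dk) => s; exact: w0.
  have a0 : accel mu k 0 = 0.
    apply: (derives_unique dw (dg := fun=> 0)).
    by rewrite (_ : w = fun=> 0); [exact: derives_cst|apply/funext].
  have k0 := curvature_eq_gt0 0 h.
  have rE : 2 * (k 0 - mu) = (k 0)^-1.
    have : (k 0)^-1 = 2 * (2 * k 0)^-1 by field; rewrite gt_eqF.
    by move: a0; rewrite /accel; lra.
  have r0 : 0 < (k 0)^-1 by rewrite invr_gt0.
  have xE t : angle_x mu k w t = (k 0)^-1 * cos t by rewrite /angle_x kE w0 rE; ring.
  have yE t : angle_y mu k w t = (k 0)^-1 * sin t by rewrite /angle_y kE w0 rE; ring.
  exists 0, (k 0)^-1; split => //; apply/seteqP; split => z; rewrite /= subr0 dotE.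
  - move=> /gE[t ->]; rewrite vec20 vec21 xE yE.
    transitivity ((k 0)^-1 ^+ 2 * (cos t ^+ 2 + sin t ^+ 2)); first by ring.
    by rewrite cos2Dsin2 mulr1.
  - move=> hz; have [t [ct st]] : exists t, cos t = z 0 0 * k 0 /\ sin t = z 0 1 * k 0.
      apply: unit_angle; transitivity ((z 0 0 * z 0 0 + z 0 1 * z 0 1) * k 0 ^+ 2).
        by ring.
      by rewrite hz; field; rewrite gt_eqF.
    apply/gE; exists t; rewrite xE yE ct st [LHS]vec2_eta.
    by congr vec2; field; rewrite gt_eqF.
- exfalso.
  have eN : e = -1.
    have /eqP := e2; rewrite sqrf_eq1 => /orP[/eqP e1|/eqP //].
    by move: mu0; rewrite /mu e1 mul1r ltNge l0.
  have pk : periodic k (2 * pi) by move=> s; have [] := per s.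
  have pw : periodic w (2 * pi) by move=> s; have [] := per s.
  have [px py] := periodic_angle mu pk pw.
  have p20 : 0 < 2 * pi :> R by rewrite mulr_gt0 ?pi_gt0.
  pose Z t := vec2 (angle_x mu k w t) (angle_y mu k w t).
  have cg : compact g.
    have -> : g = Z @` `[0, 2 * pi].
      apply/seteqP; split => z; last by case=> t _ <-; apply/gE; exists t.
      move=> /gE[t ->]; have [t' t'i E] := periodic_window t p20.
      by exists t'; [rewrite /= in_itv|rewrite /Z (E _ px) (E _ py)].
    apply: continuous_compact; last exact: segment_compact.
    apply: continuous_subspaceT.
    exact: (vec2_continuous (derives_angle_x h) (derives_angle_y h)).
  have [t0 [r0 wt0 far]] := exists_farthest h pk pw.
  have gZ : g (Z t0) by apply/gE; exists t0.
  (* As [e = - 1], [- n] is the outward radial direction at the farthest point. *)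
  have [t [+ t_gt0]] : exists t, enclosed g (Z t0 - t *: n (Z t0)) /\ 0 < t.
    have := out cg _ gZ; move/(filterI (nbhs_right_gt 0))/filter_ex.
    by move=> [t [? []]]; exists t.
  have -> : Z t0 - t *: n (Z t0) =
      vec2 ((2 * (k t0 - mu) + t) * cos t0) ((2 * (k t0 - mu) + t) * sin t0).
    rewrite /Z nE; apply: rV2P; rewrite !mxE /= /angle_x /angle_y wt0 eN; ring.
  apply: not_enclosed_ray; first exact: cos2Dsin2.
  - move=> z /gE[s ->]; rewrite vec20 vec21; apply: (le_lt_trans (far s)).
    by rewrite ltr_sqr ?nnegrE; lra.
  - lra.
Qed.

End Closing.

(** * Lines and circles *)

Section Classification.
Context {R : realType}.
Implicit Types (lambda mu e : R) (x y p q : R -> R)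
  (g : set 'rV[R]_2) (n : 'rV[R]_2 -> 'rV[R]_2).

Lemma flow_circle lambda e g n x y p q : 0 <= lambda -> e ^+ 2 = 1 ->
  flow (e * lambda) x y p q -> 0 < kappa (e * lambda) x y p q 0 ->
  (forall z, g z <-> exists s, z = vec2 (x s) (y s)) ->
  (forall s, n (vec2 (x s) (y s)) = vec2 (e * q s) (- (e * p s))) ->
  (compact g -> outward_pointing g n) -> is_round_circle g.
Proof.
move=> l0 e2 h k0 gE nE out.
have [sigma [k [w [hk surj qp xE yE]]]] := flow_angle h k0.
apply: (angle_curve_circle l0 e2 hk _ _ out) => [z|t].
- rewrite gE; split=> -[s ->].
  + by have [t <-] := surj s; exists t; rewrite /angle_x /angle_y xE yE.
  + by exists (sigma s); rewrite xE yE.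
- rewrite /angle_x /angle_y -xE -yE nE; have [-> ->] := qp t.
  by rewrite mulrN opprK.
Qed.

(** By [flow_gaussian] the curvature vanishes everywhere as soon as it vanishes
    once. *)
Lemma flow_line mu x y p q : flow mu x y p q -> kappa mu x y p q 0 = 0 ->
  forall s, x s = x 0 + s * p 0 /\ y s = y 0 + s * q 0.
Proof.
move=> h k0; have [dx dy dp dq _] := h.
have kE s : kappa mu x y p q s = 0.
  have := flow_gaussian s 0 h; rewrite k0 mul0r => /eqP.
  by rewrite mulf_eq0 (gt_eqF (expR_gt0 _)) orbF => /eqP.
have pE s : p s = p 0.
  by apply: derives0_cst; apply: (derives_ext dp) => t; rewrite kE oppr0 mul0r.
have qE s : q s = q 0.
  by apply: derives0_cst; apply: (derives_ext dq) => t; rewrite kE mul0r.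
have affine (f df : R -> R) s : derives f df -> (forall t, df t = df 0) ->
    f s = f 0 + s * df 0.
  move=> hf cst; have d : derives (fun t => f t - t * df 0) (fun=> 0).
    by apply: derives_ext; [derive_tac|move=> t /=; rewrite (cst t); ring].
  by have := derives0_cst d s 0; rewrite mul0r; lra.
by move=> s; split; exact: affine.
Qed.

End Classification.

Theorem theorem1p5 (R : realType) (lambda : R) (g : set 'rV[R]_2)
    (n : 'rV[R]_2 -> 'rV[R]_2)
    (lambda_ge0 : 0 <= lambda)
    (g_nonempty : g !=set0)
    (g_connected : connected g)
    (g_embedded : embedded_curve g)
    (g_complete : complete_curve g)
    (n_normal : unit_normal g n)
    (n_outward : compact g -> outward_pointing g n)
    (g_lambda : lambda_curve lambda g n) :
  is_line g \/ is_round_circle g.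
Proof.
have [p0 gp0] := g_nonempty; have [c hc _] := g_complete p0 gp0.
have [e [e2 hf nE]] := arclength_flow n_normal g_lambda hc.
have rc := range_arclength g_connected g_embedded g_complete n_normal g_lambda hc.
have gE z : g z <-> exists s, z = vec2 (c s 0 0) (c s 0 1).
  rewrite -rc; split=> [[s _ <-]|[s ->]]; exists s => //; first exact: vec2_eta.
  exact: vec2_eta.
have [k0|k0|/esym k0] := ltgtP 0 (kappa (e * lambda) (fun s => c s 0 0) (fun s => c s 0 1)
    (fun s => derive1 c s 0 0) (fun s => derive1 c s 0 1) 0).
- right; apply: (flow_circle lambda_ge0 e2 hf k0 gE _ n_outward) => s.
  by rewrite -vec2_eta [LHS]vec2_eta; have [-> ->] := nE s.
- right; have e2' : (- e) ^+ 2 = 1 by rewrite sqrrN.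
  have hf' := flow_reverse hf; rewrite -mulNr in hf'.
  apply: (flow_circle lambda_ge0 e2' hf' _ _ _ n_outward).
  + by move: k0; rewrite /kappa oppr0; lra.
  + move=> z; rewrite gE; split=> -[s ->].
      by exists (- s); rewrite opprK.
    by exists (- s).
  + move=> s; rewrite -vec2_eta [LHS]vec2_eta; have [-> ->] := nE (- s).
    by rewrite !mulrNN.
- left; exists (c 0), (derive1 c 0); split.
    have [_ _ uc] := hc; apply/eqP => c0; have := uc 0.
    by rewrite c0 dotE !mxE !mul0r addr0 => /esym/eqP; rewrite oner_eq0.
  suff cE : c = fun t => c 0 + t *: derive1 c 0 by rewrite -rc {1}cE.
  apply/funext => s; have [hx hy] := flow_line hf k0 s.
  by apply: rV2P; rewrite !mxE.
Qed.
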